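(* Fix $2\le p<\infty$. Let $P_1,\dots,P_l\in\mathbb{C}[x]$ be pairwise coprime and let $U_1,\dots,U_l\in\mathbb{C}[x]$ be such that $$\sum_{j=1}^l U_j\prod_{i\ne j}P_i=1.$$ Let $\alpha=\{\alpha_n\}_{n=0}^\infty$ be a complex sequence and let $S$ be the shift operator on sequences. Then the following are equivalent: (i) $\alpha\in\ell^p$ and $P_1(S)\cdots P_l(S)\alpha\in\ell^2$; (ii) if we define $\beta^{(j)}=U_j(S)\prod_{i\ne j}P_i(S)\,\alpha$ for $j=1,\dots,l$, then $\beta^{(j)}\in\ell^p$ and $P_j(S)\beta^{(j)}\in\ell^2$ for all $j=1,\dots,l$, and $\alpha=\beta^{(1)}+\dots+\beta^{(l)}$; (iii) there exist sequences $\beta^{(1)},\dots,\beta^{(l)}\in\ell^p$ such that $\alpha=\beta^{(1)}+\dots+\beta^{(l)}$ and $P_j(S)\beta^{(j)}\in\ell^2$ for $j=1,\dots,l$.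
   Context: The shift operator $S$ acts on complex sequences $x=\{x_n\}_{n=0}^\infty$ by $(Sx)_n=x_{n+1}$; for a polynomial $Q(x)=\sum_m q_m x^m\in\mathbb{C}[x]$, $Q(S)=\sum_m q_m S^m$ (with $S^0$ the identity). $\ell^p$ denotes the space of $p$-summable complex sequences indexed by $n\ge 0$. An empty product of polynomials is $1$. *)

(* Defs.v *)
From mathcomp Require Import all_boot all_order all_algebra.
From mathcomp Require Import all_classical all_reals all_analysis.
From mathcomp Require Export complex.

Set Implicit Arguments.
Unset Strict Implicit.
Unset Printing Implicit Defensive.

Import Order.TTheory GRing.Theory Num.Theory numFieldNormedType.Exports.

Local Open Scope classical_set_scope.
Local Open Scope ring_scope.
Local Open Scope complex_scope.

Definition cseq (R : realType) : Type := nat -> R[i].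

Definition shift (R : realType) (x : cseq R) : cseq R := fun n => x n.+1.

Definition shift_poly (R : realType) (Q : {poly R[i]}) (x : cseq R) : cseq R :=
  fun n => \sum_(m < size Q) Q`_m * iter m (@shift R) x n.

Definition comp_op (R : realType) (f g : cseq R -> cseq R) :
  cseq R -> cseq R := f \o g.

(* [ComplexField.Normc.normc] is the modulus with values in [R]; the generic
   norm [`|z|] of [z : R[i]] lives in [R[i]] and has no real powers. *)
Definition ell (R : realType) (p : R) : set (cseq R) :=
  [set x | cvgn (series (fun n => ComplexField.Normc.normc (x n) `^ p))].

(* Main.v *)
(* [Q |-> Q(S)] turns products of polynomials into compositions, and each ell^p
   is a linear space stable under the shift, hence under every [Q(S)]. The
   equivalences then follow by applying the Bezout identity to [alpha], and by
   splitting [P_1(S) ... P_l(S) alpha] along [alpha = \sum_j beta_j]. *)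
Require Import Defs.
From mathcomp Require Import all_boot all_order all_algebra.
From mathcomp Require Import all_classical all_reals all_analysis.

Set Implicit Arguments.
Unset Strict Implicit.
Unset Printing Implicit Defensive.

Import Order.TTheory GRing.Theory Num.Theory numFieldNormedType.Exports.

Local Open Scope classical_set_scope.
Local Open Scope ring_scope.
Local Open Scope complex_scope.

Section ShiftPoly.
Variable R : realType.
Implicit Types (x y : cseq R) (A B : {poly R[i]}).

Lemma iter_shiftE m x n : iter m (@Defs.shift R) x n = x (m + n)%N.
Proof. by elim: m n => //= m IHm n; rewrite /Defs.shift IHm addnS. Qed.

(** Coefficients past the degree are zero by default, so the range may be enlarged. This gives
    polynomials of different sizes a common range of summation, and replaces the iterated shift by
    an index translation. *)
Lemma shift_poly_widen A N x n : (size A <= N)%N ->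
  shift_poly A x n = \sum_(m < N) A`_m * x (m + n)%N.
Proof.
move=> sAN; rewrite /shift_poly.
under eq_bigr do rewrite iter_shiftE.
rewrite (big_ord_widen _ (fun m => A`_m * x (m + n)%N) sAN) big_mkcond /=.
by apply: eq_bigr => m _; case: ltnP => // sAm; rewrite nth_default ?mul0r.
Qed.

Lemma shift_polyD A B x n :
  shift_poly (A + B) x n = shift_poly A x n + shift_poly B x n.
Proof.
rewrite !(@shift_poly_widen _ (maxn (size A) (size B))) ?leq_maxl ?leq_maxr//.
  by rewrite -big_split; apply: eq_bigr => m _; rewrite coefD mulrDl.
exact: size_polyD.
Qed.

Lemma shift_polyZ c A x n : shift_poly (c *: A) x n = c * shift_poly A x n.
Proof.
rewrite (shift_poly_widen x n (size_scale_leq c A)).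
rewrite (shift_poly_widen x n (leqnn (size A))) mulr_sumr.
by apply: eq_bigr => m _; rewrite coefZ mulrA.
Qed.

Lemma shift_poly0 x n : shift_poly 0 x n = 0.
Proof. by rewrite /shift_poly size_poly0 big_ord0. Qed.

Lemma shift_poly1 x : shift_poly 1 x = x.
Proof.
by apply/funext => n; rewrite /shift_poly size_poly1 big_ord1 coef1 mul1r.
Qed.

Lemma shift_poly_mulX A x : shift_poly (A * 'X) x = shift_poly A (Defs.shift x).
Proof.
apply/funext => n; have sAX : (size (A * 'X)%R <= (size A).+1)%N.
  by rewrite (leq_trans (size_polyMleq _ _))// size_polyX addn2.
rewrite (shift_poly_widen _ _ sAX) (shift_poly_widen _ _ (leqnn _)).
(* The constant coefficient of [A * 'X] is zero; dropping that term moves every index by one, which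
   is the extra shift applied to [x]. *)
rewrite big_ord_recl coefMX mul0r add0r.
by apply: eq_bigr => m _; rewrite coefMX lift0.
Qed.

(** Horner induction on [A]: the new factor ['X] is moved past [B] and absorbed into the
    sequence. *)
Lemma shift_polyM A B x : shift_poly (A * B) x = shift_poly A (shift_poly B x).
Proof.
elim/poly_ind: A x => [|A c IHA] x; apply/funext => n.
  by rewrite mul0r !shift_poly0.
rewrite mulrDl -mulrA (mulrC 'X) mulrA mul_polyC -[c%:P]alg_polyC.
rewrite !shift_polyD !shift_polyZ shift_poly1 !shift_poly_mulX IHA.
(* What remains is that the shift commutes with [B(S)]. *)
congr (shift_poly A _ n + _).
apply/funext => k; apply: eq_bigr => m _.
by rewrite !iter_shiftE /Defs.shift addnS.
Qed.

(** With a single polynomial in place of a composition, reordering operators becomes commutativity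
    in the polynomial ring. *)
Lemma shift_poly_prod (I : Type) (r : seq I) (D : pred I) (F : I -> {poly R[i]}) :
  \big[@comp_op R/id]_(i <- r | D i) shift_poly (F i) =
  shift_poly (\prod_(i <- r | D i) F i).
Proof.
apply: (big_rec2 (fun f A => f = shift_poly A)) => [|i A f _ ->].
  by apply/funext => x; rewrite shift_poly1.
by apply/funext => x; rewrite shift_polyM.
Qed.

Lemma shift_poly_suml (I : Type) (r : seq I) (F : I -> {poly R[i]}) x n :
  shift_poly (\sum_(i <- r) F i) x n = \sum_(i <- r) shift_poly (F i) x n.
Proof.
by apply: (big_morph (fun A => shift_poly A x n)) => [A B|];
  [exact: shift_polyD | exact: shift_poly0].
Qed.

Lemma shift_poly_sumr (I : Type) (r : seq I) A (b : I -> cseq R) :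
  shift_poly A (fun n => \sum_(i <- r) b i n) =
  fun n => \sum_(i <- r) shift_poly A (b i) n.
Proof.
apply/funext => n.
rewrite (shift_poly_widen _ _ (leqnn _)).
under [RHS]eq_bigr do rewrite (shift_poly_widen _ _ (leqnn _)).
by rewrite exchange_big; apply: eq_bigr => m _; rewrite mulr_sumr.
Qed.

End ShiftPoly.

Section Ell.
Variables (R : realType) (p : R).
Hypothesis p_gt0 : 0 < p.
Implicit Types x y : cseq R.
Local Notation normc := (@ComplexField.Normc.normc R).

Lemma normc_ge0 z : 0 <= normc z.
Proof. by case: z => a b; exact: sqrtr_ge0. Qed.

Lemma ell0 : ell p (fun=> 0 : R[i]).
Proof.
rewrite /ell/mkset (_ : series _ = cst 0); first exact: is_cvg_cst.
apply/funext => n; apply: big1 => k _.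
(* Positivity of [p] matters here, as the power of 0 with exponent 0 is 1. *)
by rewrite ComplexField.Normc.normc0 powR0// gt_eqF.
Qed.

Lemma ellD x y : ell p x -> ell p y -> ell p (fun n => x n + y n).
Proof.
move=> xp yp; pose u (z : cseq R) n := normc (z n) `^ p.
have p0 := ltW p_gt0.
apply: (@series_le_cvg _ _ (2 `^ p *: (u x + u y))).
- by move=> n; exact: powR_ge0.
- by move=> n; rewrite mulr_ge0 ?addr_ge0 ?powR_ge0.
- move=> n; rewrite /u; change (normc (x n + y n) `^ p <=
    2 `^ p * (normc (x n) `^ p + normc (y n) `^ p)).
  set a := normc (x n); set b := normc (y n).
  have a0 : 0 <= a := normc_ge0 _; have b0 : 0 <= b := normc_ge0 _.
  have m0 : 0 <= Num.max a b by rewrite le_max a0.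
  (* |a + b|^p <= (2 max(|a|, |b|))^p <= 2^p (|a|^p + |b|^p) *)
  apply: (@le_trans _ _ ((2 * Num.max a b) `^ p)).
    apply: ge0_ler_powR; rewrite ?nnegrE ?normc_ge0 ?mulr_ge0//.
    apply: le_trans (le_normcD _ _) _.
    by rewrite mulr_natl mulr2n lerD// le_max lexx ?orbT.
  rewrite powRM// ler_wpM2l ?powR_ge0//.
  by case: (leP a b) => _; rewrite ?lerDl ?lerDr powR_ge0.
- exact/is_cvg_seriesZ/is_cvg_seriesD.
Qed.

Lemma ellZ c x : ell p x -> ell p (fun n => c * x n).
Proof.
move=> xp; rewrite /ell/=.
under eq_fun do rewrite ComplexField.Normc.normcM powRM ?normc_ge0//.
exact: is_cvg_seriesZ.
Qed.

Lemma ell_shift x : ell p x -> ell p (Defs.shift x).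
Proof.
rewrite /ell/mkset; set u := fun n => normc (x n) `^ p.
(* Removing the term of index 0 preserves convergence. The series of the shifted sequence up to [n]
   is then the sum of [u] over indices from 1 to [n], hence the passage to [n.+1]. *)
rewrite -(is_cvg_series_restrict 1 u) => /cvg_ex[s].
rewrite -cvg_shiftS => us; apply/cvg_ex; exists s.
rewrite (_ : series _ = fun n => \sum_(1 <= k < n.+1) u k) //.
by apply/funext => n; rewrite big_add1.
Qed.

Lemma ell_sum (I : Type) (r : seq I) (b : I -> cseq R) :
  (forall i, ell p (b i)) -> ell p (fun n => \sum_(i <- r) b i n).
Proof.
move=> bp; elim: r => [|i r IHr].
  by under eq_fun do rewrite big_nil; exact: ell0.
by under eq_fun do rewrite big_cons; exact: ellD.
Qed.

Lemma ell_shift_poly (A : {poly R[i]}) x : ell p x -> ell p (shift_poly A x).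
Proof.
move=> xp; apply: (ell_sum _ (b := fun (m : 'I__) n => _ * iter m _ x n)) => m.
apply: ellZ; elim: (nat_of_ord m) => [|k IHk]; first exact: xp.
exact: ell_shift IHk.
Qed.

End Ell.

Theorem theorem2p1 (R : realType) (p : R) (hp : 2 <= p) (l : nat)
    (P U : 'I_l -> {poly R[i]})
    (Pcoprime : forall i j : 'I_l, i != j -> coprimep (P i) (P j))
    (bezout : \sum_(j < l) U j * \prod_(i < l | i != j) P i = 1)
    (alpha : cseq R) :
  [<-> ell p alpha /\
       ell 2 ((\big[@comp_op R/id]_(j < l) shift_poly (P j)) alpha);
       let beta (j : 'I_l) : cseq R :=
         shift_poly (U j)
           ((\big[@comp_op R/id]_(i < l | i != j) shift_poly (P i)) alpha) in
       (forall j : 'I_l,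
          ell p (beta j) /\ ell 2 (shift_poly (P j) (beta j))) /\
       alpha = (fun n => \sum_(j < l) beta j n);
       exists beta : 'I_l -> cseq R,
         [/\ forall j : 'I_l, ell p (beta j),
             alpha = (fun n => \sum_(j < l) beta j n) &
             forall j : 'I_l, ell 2 (shift_poly (P j) (beta j))]].
Proof.
have p0 : 0 < p by apply: lt_le_trans hp.
have two0 : 0 < 2 :> R by [].
have PE j : \prod_(i < l) P i = P j * \prod_(i < l | i != j) P i by rewrite (bigD1 j).
rewrite !shift_poly_prod; tfae.
- move=> [alphap alpha2] beta; split.
    move=> j; rewrite /beta !shift_poly_prod; split.
      exact: (ell_shift_poly p0 (ell_shift_poly p0 alphap)).
    (* [P j] completes the partial product, so [P_j(S) beta_j] is [U_j(S)] applied to the sequence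
       assumed to be in [ell 2]. *)
    rewrite -!shift_polyM [P j * U j]mulrC -mulrA -PE shift_polyM.
    exact: (ell_shift_poly two0 alpha2).
  (* Write [alpha] as [1(S) alpha] and expand 1 by the Bezout identity; its terms are the
     [beta j]. *)
  apply/funext => n; rewrite -[in LHS](shift_poly1 alpha) -bezout.
  rewrite shift_poly_suml; apply: eq_bigr => j _.
  by rewrite /beta shift_poly_prod shift_polyM.
- move=> [betaP alphaE]; eexists; split; [|exact: alphaE|] => j.
    exact: (betaP j).1.
  exact: (betaP j).2.
- move=> [beta [betap -> beta2]]; split; first exact: (ell_sum p0 betap).
  rewrite shift_poly_sumr; apply: (ell_sum two0) => j.
  (* For each [j] the factor [P j] is placed innermost, so that it meets [beta j] first and lands in
     [ell 2]; the other factors preserve that space. *)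
  rewrite (PE j) mulrC shift_polyM; exact: (ell_shift_poly two0 (beta2 j)).
Qed.
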